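(* Let $p$ be a prime, $q=p^e$, and let $n$ be a positive divisor of $q-1$ such that $n$ is even if $p>2$, $e$ is the multiplicative order of $p$ modulo $n$, and $(q-1)/(p-1)$ divides $n$. Let $S$ be the subgroup of order $n$ of $F_q^*$. A map ${\cal M}$ is an orientably regular embedding of the generalised Paley graph $P_q^{(n)}$ if and only if ${\cal M}$ is isomorphic to a generalised Paley map ${\cal M}_q(s)$ for some generator $s$ of $S$.
   Context: The generalised Paley graph $P_q^{(n)}$ has vertex set $F_q$, with $v,w$ adjacent iff $v-w\in S$ (note $-1\in S$). For a generator $s$ of $S$, ${\cal M}_q(s)$ is the map embedding $P_q^{(n)}$ in an oriented surface so that the rotation of neighbours of each vertex $v$ induced by the orientation is $v+1,v+s,\dots,v+s^{n-1}$. A map on an oriented surface is orientably regular if its orientation-preserving automorphism group acts transitively on its arcs (directed edges). *)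

(* Defs.v *)
From mathcomp Require Import all_boot all_order all_algebra.
From mathcomp Require Import all_fingroup all_solvable all_field.

Set Implicit Arguments.
Unset Strict Implicit.
Unset Printing Implicit Defensive.

Import GRing.Theory.

Local Open Scope ring_scope.

(* An embedding of a finite connected graph in an oriented surface (all faces
   being discs) is encoded by its darts, i.e. directed edges: [drot] maps a dart
   to the next dart around its initial vertex, in the positive orientation, and
   [drev] reverses each dart. Vertices are the cycles of [drot], edges those of
   [drev], faces those of their product. *)
Record orimap := OriMap {
  dart : finType;
  drot : {perm dart};
  drev : {perm dart};
  drev_invol : involutive drev;
  drev_nofix : forall x, drev x != x;
  orimap_connected : [transitive <<[set drot; drev]>>, on [set: dart] | 'P]
}.

(* Commutation with [drot], not just with [drot] up to inversion, means that
   orientation is preserved. *)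
Definition orimap_iso (M N : orimap) : Prop :=
  exists f : dart M -> dart N,
    [/\ bijective f,
        forall x, f (drot M x) = drot N (f x)
      & forall x, f (drev M x) = drev N (f x)].

Definition orimap_aut (M : orimap) : {set {perm dart M}} :=
  [set g : {perm dart M} |
    [forall x, (g (drot M x) == drot M (g x))
               && (g (drev M x) == drev M (g x))]].

Definition orientably_regular (M : orimap) : Prop :=
  [transitive orimap_aut M, on [set: dart M] | 'P].

(* [f] is an isomorphism from the simple graph with adjacency [adj] to the
   graph underlying [M]: a bijection onto the vertices of [M] such that [M] has
   exactly one dart from [f u] to [f v] if [u] and [v] are adjacent, and none
   otherwise. *)
Definition embedding_of (V : finType) (adj : rel V) (M : orimap) : Prop :=
  exists f : V -> {set dart M},
    [/\ injective f, f @: [set: V] = porbits (drot M)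
      & forall u v, #|[set x in f u | drev M x \in f v]| = adj u v].

(* Stated directly rather than as an order in ['Z_n], which is not the ring of
   integers mod [n] when [n = 1]. *)
Definition mult_order (p n e : nat) : Prop :=
  [/\ 0 < e, p ^ e = 1 %[mod n]
    & forall k, 0 < k -> p ^ k = 1 %[mod n] -> e <= k]%N.

Definition unit_set (F : finFieldType) (S : {group {unit F}}) : {set F} :=
  [set val u | u in S].

Definition paley_graph (F : finFieldType) (S : {group {unit F}}) : rel F :=
  fun v w => v - w \in unit_set S.

(* What makes [paley_graph S] an undirected connected graph; the second equation
   is about the additive group of [F]. *)
Definition paley_set (F : finFieldType) (S : {group {unit F}}) : Prop :=
  -1 \in unit_set S /\ <<unit_set S>>%g = [set: F].

Section PaleyMap.

Variables (F : finFieldType) (S : {group {unit F}}).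

Lemma unit_setM (s : {unit F}) x :
  s \in S -> x \in unit_set S -> val s * x \in unit_set S.
Proof.
by move=> sS /imsetP[u uS ->]; apply/imsetP; exists (s * u)%g; rewrite ?groupM.
Qed.

Definition paley_arc : finType := {a : F * F | paley_graph S a.1 a.2}.

Hypothesis SP : paley_set S.
Variable s : {unit F}.
Hypothesis gen_s : generator S s.

Lemma gen_mem : s \in S.
Proof. by rewrite (eqP gen_s) cycle_id. Qed.

Lemma paley_rot_subproof (a : paley_arc) :
  paley_graph S (val a).1
    ((val a).1 + val s * ((val a).2 - (val a).1)).
Proof.
case: a => -[v w] /= vw; rewrite /paley_graph opprD addrA subrr add0r -mulrN.
by rewrite opprB unit_setM ?gen_mem.
Qed.

(* The neighbours of [v] are the [v + s ^+ i], and the next one after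
   [v + s ^+ i] in the rotation is [v + s ^+ i.+1]. *)
Definition paley_rot_fun (a : paley_arc) : paley_arc :=
  Sub ((val a).1, (val a).1 + val s * ((val a).2 - (val a).1))
      (paley_rot_subproof a).

Lemma unit_neq0 (u : {unit F}) : val u != 0.
Proof. by rewrite -unitfE (valP u). Qed.

Lemma paley_rot_inj : injective paley_rot_fun.
Proof.
move=> [[v w] vw] [[v' w'] vw'] /(congr1 val) /= [e1 e2].
apply: val_inj => /=; rewrite -e1 in e2 *; congr (_, _).
by move/addrI/(mulfI (unit_neq0 s))/addIr: e2.
Qed.

Lemma paley_rev_subproof (a : paley_arc) : paley_graph S (val a).2 (val a).1.
Proof.
case: SP => /imsetP[m mS mE] _; case: a => -[v w] /= vw.
by rewrite /paley_graph -opprB -mulN1r mE unit_setM.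
Qed.

Definition paley_rev_fun (a : paley_arc) : paley_arc :=
  Sub ((val a).2, (val a).1) (paley_rev_subproof a).

Lemma paley_rev_invol : involutive paley_rev_fun.
Proof. by move=> [[v w] vw]; apply: val_inj. Qed.

Definition paley_rot : {perm paley_arc} := perm paley_rot_inj.
Definition paley_rev : {perm paley_arc} := perm (inv_inj paley_rev_invol).

Lemma paley_rev_permK : involutive paley_rev.
Proof. by move=> a; rewrite !permE paley_rev_invol. Qed.

Lemma paley_rev_nofix a : paley_rev a != a.
Proof.
rewrite permE; case: a => -[v w] vw; apply/eqP => /(congr1 val) /= [wv _].
move: vw; rewrite /paley_graph /= wv subrr => /imsetP[u _ u0].
by case/eqP: (unit_neq0 u).
Qed.

Lemma paley_base_subproof v : paley_graph S v (v - 1).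
Proof.
by rewrite /paley_graph opprB addrC subrK; apply/imsetP; exists 1%g.
Qed.

Let base v : paley_arc := Sub (v, v - 1) (paley_base_subproof v).
Let G := <<[set paley_rot; paley_rev]>>%G.
Let orb := orbit 'P G.

Lemma paley_orbit_rot (a : paley_arc) : orb a = orb (base (val a).1).
Proof.
apply/orbit_eqP; case: a => -[v w] vw /=.
have [u uS uE0] := imsetP vw; have uE : v - w = val u by [].
have /cycleP[i uE'] : u \in <[s]>%g by rewrite -(eqP gen_s).
have rG : paley_rot \in G by rewrite mem_gen ?inE ?eqxx.
apply/orbitP; exists (paley_rot ^+ i)%g; first by rewrite groupX.
rewrite /= /aperm; apply: val_inj => /=.
have -> : w = v - val u by rewrite -uE opprB addrC subrK.
rewrite {}uE' {u uS uE uE0 vw w}; elim: i => [|i IHi].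
  by rewrite expg0 perm1.
rewrite expgSr permM permE /= IHi /=; congr (_, _ + _).
by rewrite [X in _ * X]addrC addrA addNr add0r mulrN expgS.
Qed.

Lemma paley_orbit_base u v : orb (base (v + u)) = orb (base v).
Proof.
pose K := [set u | [forall v, orb (base (v + u)) == orb (base v)]].
have K1 : group_set K.
  apply/group_setP; split=> [|x y]; rewrite !inE.
    by apply/forallP => w; rewrite addr0.
  move=> /forallP Kx /forallP Ky; apply/forallP => w.
  by rewrite [(x * y)%g]/(x + y) addrA (eqP (Ky _)) (eqP (Kx _)).
suff: [set: F] \subset K.
  by move/subsetP/(_ u (in_setT u)); rewrite inE => /forallP/(_ v)/eqP.
rewrite -(proj2 SP) (gen_subG _ (Group K1)); apply/subsetP => x xS /=.
rewrite inE; apply/forallP => w.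
have arcP : paley_graph S (w + x) w by rewrite /paley_graph addrC addKr.
pose a : paley_arc := Sub (w + x, w) arcP.
rewrite -(paley_orbit_rot a) -[w in base w]/((val (paley_rev_fun a)).1).
rewrite -paley_orbit_rot eq_sym; apply/eqP/orbit_eqP.
rewrite -[paley_rev_fun a](permE (inv_inj paley_rev_invol)).
by apply: (mem_orbit 'P); rewrite mem_gen // !inE eqxx orbT.
Qed.

Lemma paley_connected :
  [transitive <<[set paley_rot; paley_rev]>>, on [set: paley_arc] | 'P].
Proof.
apply/imsetP; exists (base 0); rewrite ?inE //; apply/esym/setP => a.
rewrite inE; apply/orbit_eqP; rewrite -/orb paley_orbit_rot.
by rewrite -[(val a).1]add0r paley_orbit_base.
Qed.

Definition paley_map : orimap :=
  OriMap paley_rev_permK paley_rev_nofix paley_connected.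

End PaleyMap.

Lemma paley_setP (p e q n : nat) (F : finFieldType) (S : {group {unit F}}) :
    prime p -> q = (p ^ e)%N -> #|F| = q -> (2 < p -> ~~ odd n)%N ->
    mult_order p n e -> #|S| = n ->
  paley_set S.
Proof.
move=> p_pr -> cardF n_even [e_gt0 pe_n e_min] cardS; split.
  have [p2|p_gt2] : (p = 2 \/ 2 < p)%N.
  - by move: (prime_gt1 p_pr); rewrite leq_eqVlt => /predU1P[]; [left | right].
  - have [x _ ox] : {x : F | x \in [set: F] & #[x]%g = 2}.
      by apply: Cauchy; rewrite ?cardsT // cardF p2 dvdn_exp.
    have x_neq0 : x != 0.
      by apply/eqP => x0; move: ox; rewrite x0 [0]/(1%g) order1.
    have xx : x + x = 0 by have:= expg_order x; rewrite ox.
    have m1 : 1 = -1 :> F.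
      apply/eqP; rewrite -addr_eq0; apply/eqP/(mulIf x_neq0).
      by rewrite mulrDl mul1r xx mul0r.
    by rewrite -m1; apply/imsetP; exists 1%g.
  have [u uS ou] : {u : {unit F} | u \in S & #[u]%g = 2}.
    by apply: Cauchy; rewrite // cardS dvdn2 n_even.
  apply/imsetP; exists u => //; apply/esym/eqP.
  have uu : val u ^+ 2 = 1.
    by have:= expg_order u; rewrite ou => /(congr1 val).
  have /orP[/eqP u1|//] : (val u == 1) || (val u == -1) by rewrite -sqrf_eq1 uu.
  suff u1' : u = 1%g by move: ou; rewrite u1' order1.
  exact: val_inj.
set K := <<unit_set S>>%g.
have pK : (p.-group K)%g.
  by apply: (pgroupS (subsetT _)); rewrite /pgroup cardsT cardF pnatX pnat_id.
have [k cardK] := p_natP pK.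
have K1 : (1 : F) \in K by apply: mem_gen; apply/imsetP; exists 1%g.
have k_gt0 : (0 < k)%N.
  case: k cardK => // cK1; have K_1 : K = 1%g by exact: card1_trivg.
  by move: K1; rewrite K_1 => /set1gP/eqP; rewrite oner_eq0.
have KS u x : u \in S -> x \in K -> x * val u \in K.
  move=> uS; pose K' := [set x | x * val u \in K].
  have K'g : group_set K'.
    apply/group_setP; split=> [|y z]; rewrite !inE ?mul0r ?group1 //.
    by rewrite [(y * z)%g]/(y + z) mulrDl; apply: groupM.
  suff /subsetP sKK' : K \subset K' by move/sKK'; rewrite inE.
  rewrite (gen_subG _ (Group K'g)); apply/subsetP => _ /imsetP[v vS ->] /=.
  rewrite inE; apply/mem_gen/imsetP; exists (v * u)%g => //.
  exact: groupM.
have n_dvd : (n %| p ^ k - 1)%N.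
  have <- : #|K^#%g| = (p ^ k - 1)%N.
    by rewrite -cardK [in RHS](cardsD1 1%g) group1 addKn.
  have actsK : [acts S, on K^#%g | 'U].
    have stab u x : u \in S -> x \in K^#%g -> x * val u \in K^#%g.
      move=> uS /setD1P[x0 xK]; apply/setD1P; split; last exact: KS.
      by rewrite mulf_neq0 // unit_neq0.
    apply/actsP => u uS x; apply/idP/idP; last exact: stab.
    move=> xuK; have := stab _ _ (groupVr uS) xuK.
    by rewrite -[_ * _]/('U%act ('U%act x u) u^-1%g) actK.
  rewrite -(acts_sum_card_orbit actsK); apply: dvdn_sum => _ /imsetP[x xK ->].
  rewrite card_in_imset ?cardS // => u v uS vS /=.
  case/setD1P: xK => x0 _ /(mulfI x0); exact: val_inj.
have e_le_k : (e <= k)%N.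
  apply: e_min => //; apply/eqP; rewrite eqn_mod_dvd //.
  by rewrite expn_gt0 prime_gt0.
apply/eqP; rewrite eqEcard subsetT cardsT cardF cardK.
by rewrite leq_exp2l ?prime_gt1.
Qed.

(* Main.v *)
Require Import Defs.
From mathcomp Require Import all_boot all_order all_algebra.
From mathcomp Require Import all_fingroup all_solvable all_field.
From mathcomp Require Import integral_char.

(* Let [G] be the automorphism group of an orientably regular embedding, [c] and
   [j] the automorphisms taking a base dart [x0] to [drot x0] and [drev x0], and
   [C = <[c]>] the stabiliser of the initial vertex of [x0]. Then [G] is regular
   on darts, [C] is cyclic of order [n] and index [q = p ^ e], and
   [C :&: C :^ j = 1] because the graph is simple.
   As [C] is abelian of prime power index, Burnside's theorem on classes of prime
   power size makes [G] solvable. Since ['O_p^'(G)] lies in the core of [C], it is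
   trivial, so [C] acts faithfully on [V = 'O_p(G)]. A cyclic p'-group acting
   faithfully and reducibly on a p-group of order at most [q] has order less than
   [(q - 1) / (p - 1)]; hence [V] is irreducible under [C], elementary abelian,
   and of order [q] because [p] has order [e] mod [n]. Fourier analysis of an
   additive isomorphism from [V] to [F] along [C] yields one that turns
   conjugation by [c] into multiplication by a generator [s] of [S]. As
   [G = C * V], the darts become the arcs of the Paley map of [s]. *)

Set Implicit Arguments.
Unset Strict Implicit.
Unset Printing Implicit Defensive.

Import GRing.Theory.

(** * Solvability, coprime action, and a normal complement to the vertex stabiliser *)

Section Groups.

Local Open Scope group_scope.
Implicit Types (gT : finGroupType) (p : nat).

(* Elements of [C] have prime power class sizes, so [G] is not simple. *)
Lemma abelian_primepow_index_sol gT (G C : {group gT}) p :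
  C \subset G -> abelian C -> p.-nat #|G : C| -> solvable G.
Proof.
have [m leGm] := ubnP #|G|; elim: m => // m IHm in gT G C leGm *.
move=> sCG abC pGC.
have [/abelian_sol // | nabG] := boolP (abelian G).
have ntG : G :!=: 1 by apply: contraNneq nabG => ->; apply: abelian1.
have [C1 | /trivgPn[x Cx ntx]] := eqVneq C 1%G.
  by apply: (@pgroup_sol _ p); move: pGC; rewrite C1 indexg1.
have [H /mingroupP[/andP[ntH nHG] minH] sHG] := minnormal_exists ntG (normG G).
have nsHG : H <| G by apply/andP.
have [eqHG | neHG] := eqVneq H G; last first.
  have ltHG : #|H| < #|G| by rewrite proper_card // properEneq sHG andbT.
  have nHC := subset_trans sCG nHG.
  rewrite (series_sol nsHG); apply/andP; split.
    apply: (IHm _ _ (H :&: C)%G); rewrite ?subsetIl //=.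
    - exact: leq_trans ltHG _.
    - exact: abelianS (subsetIr _ _) abC.
    (* The index of [H :&: C] in [H] is that of [C] in the product of [H] and [C], a divisor of
       [#|G : C|]. *)
    rewrite indexgI -indexMg (normC nHC).
    apply: pnat_dvd pGC; rewrite -norm_joinEr // indexSg ?joing_subr //.
    by rewrite join_subG sHG.
  apply: (IHm _ _ (C / H)%G) => /=.
  - exact: leq_trans (ltn_quotient ntH sHG) _.
  - exact: quotientS.
  - exact: quotient_abelian.
  apply: pnat_dvd pGC; apply: index_quotient.
  by rewrite (subset_trans (subsetIl _ _)).
have simG : simple G.
  apply/simpleP; split=> // K /andP[sKG nKG].
  have [-> | ntK] := eqVneq K 1%G; [by left | right].
  by rewrite -eqHG; apply: minH; rewrite ?eqHG ?ntK.
have xG : x ^: G \in (classes G)^#.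
  by rewrite !inE classG_eq1 ntx mem_classes // (subsetP sCG).
have pxG : p.-nat #|x ^: G|.
  rewrite -index_cent1; apply: pnat_dvd pGC; apply: indexgS.
  by rewrite subsetI sCG sub_cent1 (subsetP abC).
(* In a nonabelian simple group the size of a nontrivial class has at least two prime divisors. *)
have := primes_class_simple_gt1 simG nabG xG.
rewrite ltnNge => /negP[].
apply: (@uniq_leq_size _ _ [:: p] (primes_uniq _)) => r r_x.
by rewrite inE; apply: (pnatPpi pxG).
Qed.

(** Otherwise a minimal normal subgroup of [G / Z] inside [K / Z] lifts to a normal subgroup [H] of
    [G]. Since [H / Z] is abelian and [Z] is central in [H], [H] is nilpotent, hence lies in [F] and
    so in [Z], a contradiction. *)
Lemma sol_cent_sub_Fitting gT (G : {group gT}) :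
  solvable G -> 'C_G('F(G)) \subset 'F(G).
Proof.
move=> solG; set F := 'F(G); set K := 'C_G(F); set Z := K :&: F.
have nsFG : F <| G := Fitting_normal G.
have nsKG : K <| G.
  by rewrite /normal subsetIl normsI ?normG ?norms_cent ?normal_norm.
have nsZG : Z <| G by apply: normalI.
have nZG := normal_norm nsZG; have nZK := subset_trans (normal_sub nsKG) nZG.
apply/setIidPl; rewrite -/Z; apply/eqP; rewrite eqEsubset subsetIl /=.
rewrite -quotient_sub1 //; apply: contraT; rewrite subG1 => ntKZ.
have [L minL sLK] :=
  minnormal_exists ntKZ (quotient_norms _ (normal_norm nsKG)).
have solKZ : solvable (K / Z) := quotient_sol _ (solvableS (subsetIl _ _) solG).
have [nLG ntL /abelem_abelian abL] := minnormal_solvable minL sLK solKZ.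
have nsL : L <| G / Z.
  by apply/andP; rewrite (subset_trans sLK) ?quotientS ?subsetIl.
have [H defL sZH nsHG] := inv_quotientN nsZG nsL.
have nZH := subset_trans (normal_sub nsHG) nZG.
have sHK : H \subset K by rewrite -(quotientSGK nZH (subsetIl _ _)) -defL.
have nilH : nilpotent H.
  rewrite -quotient_center_nil; apply: abelian_nil; apply: sub_der1_abelian.
  apply: subset_trans (_ : Z \subset _).
    by apply: der1_min; rewrite // -defL.
  rewrite subsetI sZH centsC (subset_trans sHK) //.
  by rewrite (subset_trans (subsetIr _ _)) // centS ?subsetIr.
have sHZ : H \subset Z by rewrite subsetI sHK Fitting_max.
by case/eqP: ntL; rewrite defL quotientS1.
Qed.

(** Under coprime action the fixed points of [A] on [U / W] lift to fixed points in [U]. *)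
Lemma stable_factor_cents gT (A U W : {group gT}) :
    W <| U -> coprime #|U| #|A| -> solvable U ->
    A \subset 'C(W) -> [~: U, A] \subset W -> A \subset 'C(U).
Proof.
move=> /andP[sWU nWU] coUA solU cWA cUA.
have nWA : A \subset 'N(W) := subset_trans cWA (cent_sub _).
have := coprime_quotient_cent sWU nWA coUA solU.
have cUAW : U / W \subset 'C(A / W) by rewrite quotient_cents2.
rewrite (setIidPl cUAW) => eqU; rewrite centsC; apply: subset_trans (subsetIr U _).
by rewrite -(quotientSGK nWU) ?eqU // subsetI sWU centsC.
Qed.

(** As [C] is abelian, the centraliser in [W] of ['C_C[w]] is [C]-invariant; it contains [w], so by
    minimality it is [W]. *)
Lemma minnormal_abelian_semireg gT (C W : {group gT}) w :
  minnormal W C -> abelian C -> w \in W^# -> 'C_C[w] = 'C_C(W).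
Proof.
move=> /mingroupP[/andP[ntW nWC] minW] abC /setD1P[ntw Ww].
apply/eqP; rewrite eqEsubset; apply/andP; split; last first.
  by rewrite setIS // -cent_set1 centS ?sub1set.
rewrite subsetI subsetIl centsC.
apply/setIidPl; apply: (minW 'C_W('C_C[w])%G) (subsetIl _ _); apply/andP; split.
  apply/trivgPn; exists w; rewrite // inE Ww -sub_cent1; exact: subsetIr.
rewrite normsI // norms_cent // cents_norm // (subset_trans abC) // centS //.
exact: subsetIl.
Qed.

(** By semiregularity all orbits of [C] on [W^#] have length [#|C : 'C_C(W)|]. *)
Lemma minnormal_abelian_index gT (C W : {group gT}) :
  minnormal W C -> abelian C -> #|C : 'C_C(W)| %| #|W|.-1.
Proof.
move=> minW abC; have /mingroupP[/andP[ntW nWC] _] := minW.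
have actsC : [acts C, on W^# | 'J].
  by rewrite astabsJ normsD1.
have -> : #|W|.-1 = #|W^#| by rewrite (cardsD1 1 W) group1.
rewrite -(acts_sum_card_orbit actsC); apply: dvdn_sum => _ /imsetP[w Ww ->].
by rewrite card_orbit astab1J (minnormal_abelian_semireg minW).
Qed.

Lemma abelian_expg_index gT (C D : {group gT}) x :
  abelian C -> D \subset C -> x \in C -> x ^+ #|C : D| \in D.
Proof.
move=> abC sDC Cx.
have nDC : C \subset 'N(D) by rewrite cents_norm // (subset_trans abC) // centS.
have nDx := subsetP nDC x Cx.
rewrite -card_quotient //; apply: coset_idr; first exact: groupX.
by rewrite morphX // expg_cardG // mem_quotient.
Qed.

(* On an irreducible section of order [p ^ d] the exponent of the action divides
   [p ^ d - 1]. All these numbers share the factor [p - 1], which an lcm counts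
   only once: hence the gain of a factor [p - 1] when [U] is not irreducible. *)
Lemma abelian_pgroup_exponent gT (p : nat) (C U : {group gT}) :
    prime p -> p.-group U -> p^'.-group C -> abelian C -> C \subset 'N(U) ->
    U :!=: 1 ->
  exists m, [/\ 0 < m, p.-1 * m <= #|U|.-1,
                 {in C, forall x, x ^+ (p.-1 * m) \in 'C(U)}
               & minnormal U C \/ p.-1 * (p.-1 * m) < #|U|.-1].
Proof.
move=> p_pr; have [k leUk] := ubnP #|U|; elim: k => // k IHk in gT C U leUk *.
move=> pU p'C abC nUC ntU.
have ntZ : 'Z(U) != 1 by rewrite (center_nil_eq1 (pgroup_nil pU)).
have nZC : C \subset 'N('Z(U)) by apply: gFnorm_trans.
(* Taking [W] in the centre makes it normal in [U], so that induction applies to [U / W]. *)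
have [W minW sWZ] := minnormal_exists ntZ nZC.
have /mingroupP[/andP[ntW nWC] _] := minW.
have [sWU cUW] := subsetIP sWZ.
have pW := pgroupS sWU pU.
have [_ _ [a cardW]] := pgroup_pdiv pW ntW.
have dvdW : p.-1 %| #|W|.-1.
  by rewrite cardW dvdn_pred_predX.
pose m1 := #|W|.-1 %/ p.-1.
have defW : (p.-1 * m1)%N = #|W|.-1 by rewrite mulnC divnK.
have m1_gt0 : 0 < m1.
  rewrite lt0n; apply: contraNneq ntW => m1_0.
  by rewrite trivg_card1 -(prednK (cardG_gt0 W)) -defW m1_0 muln0.
have expW x : x \in C -> x ^+ (p.-1 * m1) \in 'C(W).
  move=> Cx; rewrite defW.
  have /dvdnP[t ->] := minnormal_abelian_index minW abC.
  rewrite mulnC expgM groupX // (subsetP (subsetIr C _)) //.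
  by rewrite abelian_expg_index ?subsetIl.
have [eqWU | neWU] := eqVneq W U.
  rewrite -eqWU; exists m1; split=> //; first by rewrite defW.
  by left.
have nWU : U \subset 'N(W) by rewrite cents_norm // centsC.
have ltUW : #|(U / W)%G| < k by apply: leq_trans (ltn_quotient ntW sWU) _.
have ntUW : (U / W)%G :!=: 1.
  apply: contra neWU; rewrite -subG1 quotient_sub1 // => sUW.
  by rewrite -val_eqE eqEsubset sWU.
have [m2 [m2_gt0 le_m2 expm2 _]] := IHk _ (C / W)%G (U / W)%G ltUW
  (quotient_pgroup _ pU) (quotient_pgroup _ p'C) (quotient_abelian _ abC)
  (quotient_norms _ nUC) ntUW.
have p1_gt0 : 0 < p.-1 by rewrite -ltnS prednK ?prime_gt1 ?prime_gt0.
(* The left side is [p.-1 * m1 = #|W|.-1] times [p.-1 * m2 <= #|U / W|.-1], and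
   [(x - 1) * (y - 1) < x * y - 1] for [x, y > 1]. *)
have lt_m : p.-1 * (p.-1 * (m1 * m2)) < #|U|.-1.
  rewrite (mulnA p.-1 m1) defW mulnCA -(Lagrange sWU) -card_quotient //.
  apply: leq_ltn_trans (leq_mul (leqnn _) le_m2) _.
  move: ntW ntUW; rewrite -!cardG_gt1 /=.
  case: #|W| => [|[|a']] //; case: #|U / W| => [|[|b']] // _ _ /=.
  rewrite ltnS; apply: leq_trans (leq_addl _ _).
  by rewrite leq_mul2l leqnSn orbT.
exists (m1 * m2)%N; split; last by right.
- by rewrite muln_gt0 m1_gt0.
- by apply: leq_trans (ltnW lt_m); rewrite leq_pmull.
(* The exponent is a multiple of both [p.-1 * m1] and [p.-1 * m2], so the power of [x] centralises
   [W] and [U / W]. *)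
move=> x Cx; rewrite -cycle_subG; apply: (@stable_factor_cents _ _ _ W) => //.
- by apply/andP.
- apply: pnat_coprime pU _.
  by apply: pgroupS p'C; rewrite cycle_subG groupX.
- exact: pgroup_sol pU.
- by rewrite cycle_subG mulnA expgM groupX ?expW.
rewrite -quotient_cents2 //; last first.
  by rewrite cycle_subG (subsetP nWC) ?groupX.
rewrite centsC quotient_cycle ?(subsetP nWC) ?groupX //.
rewrite cycle_subG morphX ?(subsetP nWC) // mulnCA mulnC expgM.
by rewrite groupX // expm2 // mem_quotient.
Qed.

(** In the application [C] and [C :^ j] are the stabilisers of two adjacent vertices. *)
Lemma cyclic_complement_minnormal gT (G C : {group gT}) j (p e : nat) :
    prime p -> C \subset G -> cyclic C -> #|G| = (p ^ e * #|C|)%N ->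
    mult_order p #|C| e -> (p ^ e - 1) %/ (p - 1) %| #|C| ->
    j \in G -> C :&: C :^ j = 1 ->
  exists V : {group gT},
    [/\ p.-abelem V, #|V| = (p ^ e)%N, V <| G, minnormal V C & 'C_C(V) = 1].
Proof.
move=> p_pr sCG cycC cardG [e_gt0 ordp ord_min] dvdC Gj tiC.
have p_gt0 := prime_gt0 p_pr; have pe_gt0 : 0 < p ^ e by rewrite expn_gt0 p_gt0.
have abC := cyclic_abelian cycC.
have p'C : p^'.-group C.
  rewrite /pgroup p'natE //; apply/negP => p_C.
  have : p %| p ^ e - 1.
    by apply: dvdn_trans p_C _; rewrite -eqn_mod_dvd //; apply/eqP.
  rewrite dvdn_subr // ?dvdn_exp //.
  by rewrite dvdn1 => /eqP p1; rewrite p1 in p_pr.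
have iGC : #|G : C| = (p ^ e)%N by rewrite -divgS // cardG mulnK.
have solG : solvable G.
  by apply: (@abelian_primepow_index_sol _ _ C p); rewrite // iGC pnatX pnat_id.
have hallC : p^'.-Hall(G) C.
  rewrite pHallE sCG cardG partnM // part_p'nat ?pnatNK ?pnatX ?pnat_id //.
  by rewrite mul1n part_pnat_id ?eqxx.
(* Being normal and inside the Hall subgroup [C], it lies in [C :^ j] as well. *)
have O1 : 'O_p^'(G) = 1.
  have sOC := pcore_sub_Hall hallC.
  apply/trivgP; rewrite -tiC subsetI sOC /=.
  by rewrite -(normsP (gFnorm _ _) j Gj) conjSg.
set N := 'O_p(G)%G.
have cN : 'C_G(N) \subset N.
  by have := sol_cent_sub_Fitting solG; rewrite (Fitting_eq_pcore O1).
have pN : p.-group N := pcore_pgroup p G.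
have tiNC : N :&: C = 1 by apply: coprime_TIg; apply: pnat_coprime pN p'C.
have cCN : 'C_C(N) = 1.
  apply/trivgP; rewrite -tiNC subsetI subsetIl andbT.
  by rewrite (subset_trans _ cN) ?setSI.
have ntN : N :!=: 1.
  apply/eqP => N1; move: cN; rewrite N1 cent1T setIT => /trivgP G1.
  move: cardG; rewrite G1 cards1 => /esym/eqP; rewrite muln_eq1 => /andP[].
  by rewrite -(exp1n e) eqn_exp2r // => /eqP p1; rewrite p1 in p_pr.
have [_ _ [d cardN]] := pgroup_pdiv pN ntN.
have nNC : C \subset 'N(N) := subset_trans sCG (gFnorm _ _).
have leN : #|N| <= p ^ e.
  apply: dvdn_leq => //; rewrite -(Gauss_dvdl _ (_ : coprime _ #|C|)).
    by rewrite -cardG cardSg ?pcore_sub.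
  exact: pnat_coprime pN p'C.
have [m [m_gt0 _ expC minN]] := abelian_pgroup_exponent p_pr pN p'C abC nNC ntN.
have p1_gt0 : 0 < p.-1 by rewrite -ltnS prednK ?prime_gt1.
(* The power of a generator with this exponent centralises [N], hence is trivial. *)
have lenC : #|C| <= p.-1 * m.
  case/cyclicP: cycC => c defC.
  apply: dvdn_leq; first by rewrite muln_gt0 p1_gt0.
  rewrite defC -orderE order_dvdn -in_set1 -[[set 1]]/(1%g : {set gT}) -cCN inE.
  by rewrite groupX ?expC // defC cycle_id.
(* In the other case [p.-1 * #|C|] would be less than [p ^ e - 1], against [dvdC]. *)
have {}minN : minnormal N C.
  case: minN => // /leq_trans/(_ _) lt_m.
  have : p.-1 * (p.-1 * m) < (p ^ e).-1.
    by apply: lt_m; rewrite -!subn1 leq_sub2r.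
  rewrite ltnNge => /negP[]; apply: leq_trans (_ : p.-1 * #|C| <= _); last first.
    by rewrite leq_mul2l lenC orbT.
  rewrite -(divnK (dvdn_pred_predX p e)) mulnC leq_mul2l.
  by rewrite -!subn1 dvdn_leq ?orbT.
have [_ _] := minnormal_solvable minN (subxx _) (pgroup_sol pN).
rewrite (is_abelem_pgroup pN) => abelN.
exists N; split=> //; last exact: gFnormal.
(* The faithful irreducible action makes [#|C|] divide [p ^ d.+1 - 1], so [e <= d.+1] by minimality
   of [e]. *)
apply/eqP; rewrite eqn_leq leN cardN leq_exp2l ?prime_gt1 //=.
apply: ord_min => //; apply/eqP; rewrite eqn_mod_dvd ?expn_gt0 ?p_gt0 //.
by have := minnormal_abelian_index minN abC; rewrite cCN indexg1 cardN subn1.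
Qed.

End Groups.

(** * Linearising the action of a cyclic group *)

Section Coordinates.

Local Open Scope ring_scope.

(** Multiplying by a generator [g] permutes [S] and scales the sum by [g ^+ i], which is not 1. *)
Lemma sum_unit_group_expr (F : finFieldType) (S : {group {unit F}}) i :
  (0 < i < #|S|)%N -> \sum_(s in S) val s ^+ i = 0.
Proof.
case/andP=> i_gt0 i_lt; have /cyclicP[g defS] := field_unit_group_cyclic S.
have Sg : g \in S by rewrite defS cycle_id.
set T := \sum_(s in S) _; have eqT : T = val g ^+ i * T.
  rewrite [RHS]mulr_sumr [LHS](reindex_inj (mulgI g)).
  rewrite (eq_bigl _ _ (fun s => groupMl s Sg)).
  by apply: eq_bigr => s _; rewrite FinRing.val_unitM exprMn.
apply/eqP; apply: contraTT i_lt => T_neq0; rewrite -leqNgt.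
apply: dvdn_leq => //; rewrite defS -orderE order_dvdn; apply/eqP/val_inj.
rewrite FinRing.val_unitX; apply: (mulIf T_neq0).
by rewrite -eqT FinRing.val_unit1 mul1r.
Qed.

(** [#|S|] divides [#|F|.-1], whose image in [F] is -1. *)
Lemma card_unit_group_neq0 (F : finFieldType) (S : {group {unit F}}) :
  #|S|%:R != 0 :> F.
Proof.
have /dvdnP[k defq] : (#|S| %| #|F|.-1)%N.
  by rewrite -card_finField_unit cardSg ?subsetT.
have q0 : #|F|%:R = 0 :> F.
  by have := expg_cardG (in_setT (1 : F)); rewrite cardsT.
apply/eqP => S0; move: q0; rewrite -(@prednK #|F|); last first.
  by apply/card_gt0P; exists 0.
rewrite defq -natr1 natrM S0 mulr0 add0r; apply/eqP; exact: oner_neq0.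
Qed.

Lemma minnormal_cycle_coordinates (gT : finGroupType) (V : {group gT}) c w
    (p e : nat) (F : finFieldType) (S : {group {unit F}}) :
    prime p -> p.-abelem%g V -> #|V| = (p ^ e)%N -> #|F| = (p ^ e)%N ->
    #[c]%g = #|S| -> minnormal V <[c]>%g -> 'C_(<[c]>)(V)%g = 1%g ->
    w \in V^#%g ->
  exists (psi : gT -> F) (s : {unit F}),
    [/\ {in V &, {morph psi : x y / (x * y)%g >-> x + y}},
        {in V &, injective psi},
        {in V, forall v, psi (v ^ c)%g = val s * psi v},
        psi w = 1 & generator S s].
Proof.
move=> p_pr abelV cardV cardF oc minV cCV Vw.
have /mingroupP[/andP[ntV nVC] minV'] := minV.
have /setD1P[ntw Vw'] := Vw.
have VC v i : v \in V -> (v ^ (c ^+ i))%g \in V.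
  by move=> Vv; rewrite memJ_norm // (subsetP nVC) ?mem_cycle.
have Vc v : v \in V -> (v ^ c)%g \in V by apply: (VC v 1%N).
have : V \isog [set: F].
  rewrite (isog_abelem_card _ abelV) cardsT cardF cardV eqxx andbT.
  exact: fin_ring_pchar_abelem (card_finPcharP cardF p_pr).
case/isogP=> h injh _.
have hM : {in V &, {morph h : x y / (x * y)%g >-> x + y}} := morphM h.
(* Up to the factor [#|S|], this is the Fourier component of [h] on which conjugation by [c] acts as
   multiplication by [s]. *)
pose Psi (s : {unit F}) v := \sum_(i < #|S|) val s ^- i * h (v ^ (c ^+ i))%g.
have PsiM s : {in V &, {morph Psi s : x y / (x * y)%g >-> x + y}}.
  move=> x y Vx Vy; rewrite /Psi -big_split /=; apply: eq_bigr => i _.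
  by rewrite conjMg hM ?VC // mulrDr.
have PsiJ s v : s \in S -> Psi s (v ^ c)%g = val s * Psi s v.
  move=> Ss; rewrite /Psi mulr_sumr.
  case: #|S| (cardG_gt0 S) (oc) (expg_cardG Ss) => // n _ ocn sn.
  (* Conjugation by [c] shifts the terms cyclically: the last one on the left matches [i = 0] on the
     right, as [c] and [s] are killed by the exponent [#|S|]. *)
  rewrite big_ord_recr [RHS]big_ord_recl /= addrC; congr (_ + _).
    rewrite -conjgM -expgS -ocn expg_order conjg1 expr0 invr1 mul1r.
    congr (_ * _); apply: (mulIf (expf_neq0 n (unit_neq0 s))).
    rewrite mulVf ?expf_neq0 ?unit_neq0 // -exprS -FinRing.val_unitX sn.
    exact: FinRing.val_unit1.
  apply: eq_bigr => i _; rewrite -conjgM -expgS mulrA; congr (_ * _).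
  by rewrite exprS invfM mulrA divff ?mul1r ?unit_neq0.
have [s Ss Psiw] : exists2 s, s \in S & Psi s w != 0.
  have hw : h w != 0.
    apply: contra ntw => /eqP hw0.
    by rewrite -(morph_injm_eq1 injh) //; apply/eqP.
  apply/exists_inP; apply: contraT; rewrite negb_exists_in => /forall_inP Psi0.
  case/eqP: (mulf_neq0 (card_unit_group_neq0 S) hw).
  (* Fourier inversion: after exchanging the sums only [i = 0] survives and gives
     [#|S|%:R * h w]. *)
  transitivity (\sum_(s in S) Psi s w); last first.
    by rewrite big1 // => s /Psi0/negPn/eqP.
  rewrite /Psi exchange_big /=.
  rewrite (bigD1 (Ordinal (cardG_gt0 S))) //= [X in _ + X]big1 ?addr0 => [|i i_neq0].
    rewrite -mulr_suml conjg1; congr (_ * _).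
    by under eq_bigr do rewrite expr0 invr1; rewrite sumr_const.
  rewrite -mulr_suml (reindex_inj invg_inj) (eq_bigl _ _ (@groupV _ S)) /=.
  rewrite (eq_bigr (fun s : {unit F} => val s ^+ i)) => [|s _]; last first.
    by rewrite exprVn invrK.
  by rewrite sum_unit_group_expr ?mul0r // lt0n i_neq0 ltn_ord.
pose psi v := Psi s v / Psi s w.
have psiM : {in V &, {morph psi : x y / (x * y)%g >-> x + y}}.
  by move=> x y Vx Vy; rewrite /psi PsiM // mulrDl.
have psiJ v : psi (v ^ c)%g = val s * psi v by rewrite /psi PsiJ // mulrA.
have psiw : psi w = 1 by rewrite /psi divff.
have psiJX v i : psi (v ^ (c ^+ i))%g = val s ^+ i * psi v.
  elim: i => [|i IHi]; first by rewrite expg0 conjg1 mul1r.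
  by rewrite expgSr conjgM psiJ IHi mulrA exprS.
pose f : {morphism V >-> F} := Morphism psiM.
(* The kernel is stable under [c], so by minimality it is trivial or [V]; the latter contradicts
   [psi w = 1]. *)
have injf : ('injm f)%g.
  apply: contraT => nker.
  have kerV : ('ker f)%g = V.
    apply: (minV' ('ker f)%G); last exact: subsetIl.
    rewrite -subG1 nker cycle_subG inE.
    apply/subsetP => _ /imsetP[v Kv ->].
    have Vv : v \in V := subsetP (subsetIl _ _) v Kv.
    apply/(kerP f (Vc v Vv)); rewrite /= psiJ.
    move/(kerP f Vv): Kv => /= ->; exact: mulr0.
  have /(kerP f Vw') /= psiw0 : w \in ('ker f)%g by rewrite kerV.
  by case/eqP: (oner_neq0 F); rewrite -psiw.
exists psi, s; split=> //; first exact: (injmP injf).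
(* [c ^+ #[s]] fixes [w], hence is trivial by semiregularity and faithfulness; so the order of [c],
   which is [#|S|], divides that of [s]. *)
rewrite /generator eq_sym eqEcard cycle_subG Ss -oc.
apply: dvdn_leq; rewrite ?order_gt0 // order_dvdn -in_set1.
rewrite -[[set 1]%g]/(1%g : {set gT}) -cCV.
rewrite -(minnormal_abelian_semireg minV (cycle_abelian c) Vw) inE mem_cycle.
apply/cent1P/commute_sym/commgP/conjg_fixP/(injmP injf); rewrite ?VC //=.
by rewrite psiJX -FinRing.val_unitX expg_order mul1r.
Qed.

End Coordinates.

(** * Valency and number of arcs of the Paley graph *)

Section PaleyGraph.

Local Open Scope ring_scope.

Variables (F : finFieldType) (S : {group {unit F}}).

Lemma card_unit_set : #|unit_set S| = #|S|.
Proof. by rewrite card_imset //; apply: val_inj. Qed.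

Lemma paley_degree u : (\sum_v paley_graph S u v = #|S|)%N.
Proof.
rewrite -card_unit_set -sum1_card [RHS]big_mkcond /=.
rewrite (reindex_inj (subrI u)) /=; apply: eq_bigr => v _.
by rewrite /paley_graph opprB addrC subrK; case: ifP.
Qed.

Lemma card_paley_arc : #|{: paley_arc S}| = (#|F| * #|S|)%N.
Proof.
rewrite card_sig -[LHS]sum1_card [LHS]big_mkcond /=.
rewrite -(pair_bigA _ (fun u v => if paley_graph S u v then 1%N else 0%N)) /=.
rewrite (eq_bigr (fun=> #|S|)) ?sum_nat_const // => u _.
by rewrite -(paley_degree u); apply: eq_bigr => v _; case: ifP.
Qed.

End PaleyGraph.

(** * Counting darts of an embedded graph *)

Section Embedding.

Variables (V : finType) (adj : rel V) (M : orimap) (f : V -> {set dart M}).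
Hypotheses (f_inj : injective f) (fP : f @: [set: V] = porbits (drot M)).
Hypothesis f_adj :
  forall u v, #|[set x in f u | drev M x \in f v]| = adj u v.

Lemma vertex_porbit u x : (x \in f u) = (f u == porbit (drot M) x).
Proof.
have /imsetP[y _ ->] : f u \in porbits (drot M) by rewrite -fP imset_f.
by rewrite eq_porbit_mem porbit_sym.
Qed.

Lemma sum_vertex x : \sum_u (x \in f u) = 1.
Proof.
have /imsetP[u _ fu] : porbit (drot M) x \in f @: [set: V].
  by rewrite fP imset_f.
rewrite (bigD1 u) //= vertex_porbit fu eqxx big1 // => v.
by rewrite vertex_porbit fu => /negPf v_u; rewrite (inj_eq f_inj) v_u.
Qed.

(** Darts at [u] are sorted by their terminal vertex. *)
Lemma card_vertex u : #|f u| = \sum_v adj u v.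
Proof.
rewrite -sum1_card (eq_bigr (fun x => \sum_v (drev M x \in f v))); last first.
  by move=> x _; rewrite sum_vertex.
rewrite exchange_big; apply: eq_bigr => v _; rewrite -f_adj -sum1_card /=.
rewrite big_mkcond [RHS]big_mkcond; apply: eq_bigr => x _; rewrite inE.
by case: (_ \in _); case: (_ \in _).
Qed.

Lemma card_embedding : #|{: dart M}| = \sum_u \sum_v adj u v.
Proof.
rewrite -sum1_card (eq_bigr (fun x => \sum_u (x \in f u))); last first.
  by move=> x _; rewrite sum_vertex.
rewrite exchange_big; apply: eq_bigr => u _; rewrite -card_vertex -sum1_card.
by rewrite [RHS]big_mkcond; apply: eq_bigr => x _; case: (_ \in _).
Qed.

Lemma card_porbit_embedding k x :
  (forall u, \sum_v adj u v = k) -> #|porbit (drot M) x| = k.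
Proof.
move=> deg; have /imsetP[u _ ->] : porbit (drot M) x \in f @: [set: V].
  by rewrite fP imset_f.
by rewrite card_vertex.
Qed.

Lemma embedding_simple x y :
  y \in porbit (drot M) x -> drev M y \in porbit (drot M) (drev M x) -> y = x.
Proof.
have im z : exists u, porbit (drot M) z = f u.
  have : porbit (drot M) z \in f @: [set: V] by rewrite fP imset_f.
  by case/imsetP=> u; exists u.
have [u xu] := im x; have [v xv] := im (drev M x).
rewrite xu xv => yu yv.
have /card_le1_eqP eq1 : #|[set z in f u | drev M z \in f v]| <= 1.
  by rewrite f_adj leq_b1.
by apply: eq1; rewrite inE ?yu // -xu -xv !porbit_id.
Qed.

End Embedding.

(** * Reconstructing the Paley map from the automorphism group *)

Section RegularMap.

Local Open Scope group_scope.

Variable M : orimap.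

(** The centraliser form provides the group structure on the automorphisms. *)
Lemma orimap_aut_cent : orimap_aut M = 'C([set drot M; drev M]).
Proof.
apply/setP => g; rewrite inE centU inE !cent_set1.
apply/forallP/andP => [com | [/cent1P comr /cent1P comv] x].
  split; apply/cent1P/permP => x; have /andP[/eqP e1 /eqP e2] := com x;
  by rewrite !permM.
by rewrite -!permM -comr -comv !permM !eqxx.
Qed.

Let G := 'C([set drot M; drev M])%G.

Lemma autM_rot g x : g \in G -> g (drot M x) = drot M (g x).
Proof.
move=> Gg; rewrite -!permM; congr (fun_of_perm _ x).
by apply/esym/(centP Gg); rewrite !inE eqxx.
Qed.

Lemma autM_rotX g x i : g \in G -> g ((drot M ^+ i) x) = (drot M ^+ i) (g x).
Proof.
move=> Gg; elim: i => [|i IHi]; first by rewrite !perm1.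
by rewrite !expgSr !permM autM_rot // IHi.
Qed.

Lemma autM_rev g x : g \in G -> g (drev M x) = drev M (g x).
Proof.
move=> Gg; rewrite -!permM; congr (fun_of_perm _ x).
by apply/esym/(centP Gg); rewrite !inE eqxx orbT.
Qed.

(** Automorphisms commute with the group generated by [drot M] and [drev M], which is transitive on
    darts. *)
Lemma autM_semireg g h x : g \in G -> h \in G -> g x = h x -> g = h.
Proof.
rewrite /= -cent_gen => Gg Gh eq_x; apply/permP => y.
have [k Kk ->] := atransP2 (orimap_connected M) (in_setT x) (in_setT y).
by rewrite /= /aperm -!permM -(centP Gg k Kk) -(centP Gh k Kk) !permM eq_x.
Qed.

Hypothesis regM : orientably_regular M.

Lemma autM_trans x : exists ga : dart M -> {perm dart M},
  forall y, ga y \in G /\ ga y x = y.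
Proof.
have trG : [transitive G, on [set: dart M] | 'P].
  by rewrite /= -orimap_aut_cent.
have P y : exists g, g \in G /\ g x = y.
  by have [g Gg ->] := atransP2 trG (in_setT x) (in_setT y); exists g.
exact: fin_all_exists P.
Qed.

Lemma card_autM (x : dart M) : #|G| = #|{: dart M}|.
Proof.
have [ga gaP] := autM_trans x.
rewrite -cardsT -(@card_in_imset _ _ (fun g : {perm dart M} => g x)).
  apply: eq_card => y; rewrite inE; apply/imsetP.
  by exists (ga y); case: (gaP y).
by move=> g h Gg Gh; apply: autM_semireg.
Qed.

Variables (p e : nat) (F : finFieldType) (S : {group {unit F}}).
Hypotheses (p_pr : prime p) (cardF : #|F| = (p ^ e)%N).
Hypotheses (ordp : mult_order p #|S| e).
Hypothesis dvdS : (p ^ e - 1) %/ (p - 1) %| #|S|.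
Hypothesis SP : paley_set S.

Hypothesis cardM : #|{: dart M}| = (#|F| * #|S|)%N.
Hypothesis degM : forall x, #|porbit (drot M) x| = #|S|.
Hypothesis simpleM : forall x y,
  y \in porbit (drot M) x -> drev M y \in porbit (drot M) (drev M x) -> y = x.

Theorem regular_map_paley :
  exists (s : {unit F}) (s_gen : generator S s),
    orimap_iso M (paley_map SP s_gen).
Proof.
have [x0 _] : exists x0 : dart M, x0 \in dart M.
  by apply/card_gt0P; rewrite cardM muln_gt0 cardG_gt0 cardF expn_gt0 prime_gt0.
have [ga gaP] := autM_trans x0.
have Gga x : ga x \in G by case: (gaP x).
have gax x : ga x x0 = x by case: (gaP x).
pose c := ga (drot M x0); pose j := ga (drev M x0).
have Gc : c \in G := Gga _; have Gj : j \in G := Gga _.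
have cx0 : c x0 = drot M x0 := gax _.
have jx0 : j x0 = drev M x0 := gax _.
have cX i : (c ^+ i) x0 = (drot M ^+ i) x0.
  elim: i => [|i IHi]; first by rewrite !expg0.
  by rewrite expgS permM cx0 autM_rot ?groupX // IHi expgSr permM.
have sCG : <[c]> \subset G by rewrite cycle_subG.
have oC : #|<[c]>| = #|S|.
  rewrite -(degM x0) -(@card_in_imset _ _ (fun g : {perm dart M} => g x0)).
    apply: eq_card => y; apply/imsetP/porbitP.
      by case=> g /cycleP[i ->] ->; exists i; rewrite cX.
    by case=> i ->; exists (c ^+ i); rewrite ?mem_cycle ?cX.
  by move=> g h /(subsetP sCG) Gg /(subsetP sCG) Gh; apply: autM_semireg.
(* An element of the intersection fixes both ends of [x0], hence the dart [x0] itself. *)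
have tiCJ : <[c]> :&: <[c]> :^ j = 1.
  apply/trivgP/subsetP => g /setIP[Cg]; rewrite mem_conjg.
  set h := g ^ j^-1 => Ch; have Gg := subsetP sCG g Cg.
  have eq_jg : j * g = h * j by rewrite /h conjgE invgK !mulgA mulgKV.
  rewrite inE; apply/eqP/(@autM_semireg _ _ x0) => //; rewrite ?group1 // perm1.
  apply: simpleM.
    by case/cycleP: Cg => i ->; rewrite cX mem_porbit.
  rewrite -autM_rev // -jx0 -permM eq_jg permM.
  by case/cycleP: Ch => i ->; rewrite cX autM_rotX // jx0 mem_porbit.
have cardG : #|G| = (p ^ e * #|<[c]>|)%N.
  by rewrite (card_autM x0) cardM cardF oC.
have [V [abelV cardV nsVG minV cCV]] := cyclic_complement_minnormal p_pr sCG
  (cycle_cyclic c) cardG (eq_ind_r (fun k => mult_order p k e) ordp oC)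
  (eq_ind_r (fun k => _ %| k) dvdS oC) (Gga _) tiCJ.
have abV := abelem_abelian abelV.
have sVG := normal_sub nsVG.
have tiCV : <[c]> :&: V = 1.
  by apply/trivgP; rewrite -cCV setIS.
have defG : <[c]> * V = G.
  apply/eqP; rewrite eqEcard mul_subG //= TI_cardMg // cardV mulnC -cardG.
  exact: leqnn.
pose a x := divgr <[c]> V (ga x); pose v x := remgr <[c]> V (ga x).
have Ca x : a x \in <[c]> by rewrite mem_divgr // defG.
have Vv x : v x \in V by rewrite mem_remgr // defG.
have gaE x : ga x = a x * v x := divgr_eq _ _ _.
have avE x b u : b \in <[c]> -> u \in V -> ga x = b * u -> a x = b /\ v x = u.
  by move=> Cb Vu eq_x; rewrite /a /v eq_x divgrMid ?remgrMid.
have nVC b u : b \in <[c]> -> u \in V -> u ^ b \in V.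
  move=> Cb Vu; rewrite memJ_norm // (subsetP (normal_norm nsVG)) //.
  exact: (subsetP sCG).
pose b := divgr <[c]> V j; pose w := remgr <[c]> V j.
have Cb : b \in <[c]> by rewrite mem_divgr // defG.
have Vw : w \in V by rewrite mem_remgr // defG.
have jE : j = b * w := divgr_eq _ _ _.
clearbody a v b w.
(* Under the identification of darts with [G], rotation and reversal become left multiplication by
   [c] and [j]. *)
have gaR x : ga (drot M x) = c * ga x.
  apply: (@autM_semireg _ _ x0); rewrite ?groupM // permM.
  by rewrite cx0 autM_rot // !gax.
have gaV x : ga (drev M x) = j * ga x.
  by apply: (@autM_semireg _ _ x0); rewrite ?groupM // permM jx0 autM_rev // !gax.
(* If [j] were in [<[c]>], then [<[c]>] would equal its conjugate by [j], hence be trivial, and [j]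
   would fix [x0]. *)
have ntw : w != 1.
  apply/eqP => w1; have Cj : j \in <[c]> by rewrite jE w1 mulg1.
  have C1 : <[c]> = 1 by rewrite -tiCJ conjGid // setIid.
  have /eqP[] := drev_nofix x0; rewrite -(gax (drev M x0)) -/j.
  by move: Cj; rewrite C1 => /set1P->; rewrite perm1.
have Vw1 : w \in V^# by rewrite !inE ntw.
have [psi [s [psiM psi_inj psiJ psiw s_gen]]] :=
  minnormal_cycle_coordinates p_pr abelV cardV cardF oC minV cCV Vw1.
have psiJX i u : u \in V -> psi (u ^ (c ^+ i)) = (val s ^+ i * psi u)%R.
  move=> Vu; elim: i => [|i IHi]; first by rewrite expg0 conjg1 mul1r.
  by rewrite expgSr conjgM psiJ ?nVC ?mem_cycle // IHi mulrA exprS.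
(* [tau x] is the coordinate of the initial vertex of [x], and [delta x] the displacement to its
   terminal vertex. *)
pose tau x := psi (v x); pose delta x := psi (w ^ a x).
have tauR x : tau (drot M x) = tau x /\ delta (drot M x) = (val s * delta x)%R.
  have [|//||aE vE] := @avE (drot M x) (c * a x) (v x).
  - by rewrite groupM ?cycle_id.
  - by rewrite gaR gaE mulgA.
  rewrite /tau /delta aE vE; split=> //.
  by rewrite (centsP (cycle_abelian c) c _ (a x)) ?cycle_id // conjgM psiJ ?nVC.
have shuffle (k t l u : {perm dart M}) :
    k * t * (l * u) = k * l * (t ^ l * u).
  by rewrite conjgE !mulgA mulgK.
have tauV x : tau (drev M x) = (tau x + delta x)%R.
  have [|||aE vE] := @avE (drev M x) (b * a x) (v x * w ^ a x).
  - by rewrite groupM.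
  - by rewrite groupM ?nVC.
  - rewrite gaV jE gaE; apply: etrans (shuffle _ _ _ _) _; congr (_ * _).
    by apply: (centsP abV); rewrite ?nVC.
  by rewrite /tau vE psiM ?nVC.
have delta_unit x : delta x \in unit_set S.
  rewrite /delta; case/cycleP: (Ca x) => i ->; rewrite psiJX // psiw mulr1.
  rewrite -FinRing.val_unitX imset_f // groupX //.
  by rewrite (eqP s_gen) cycle_id.
have arcP x : paley_graph S (tau x) (tau (drev M x)).
  rewrite /paley_graph tauV opprD addrA subrr add0r -mulN1r.
  by have [/imsetP[m Sm ->] _] := SP; rewrite unit_setM.
pose phi x : paley_arc S := Sub (tau x, tau (drev M x)) (arcP x).
exists s, s_gen, phi; split=> [|x|x].
- apply: inj_card_bij; last by rewrite card_paley_arc cardM.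
  move=> x y /(congr1 val) /= [tau_xy]; rewrite !tauV tau_xy => /addrI delta_xy.
  have v_xy : v x = v y by apply: psi_inj.
  (* Elements of [<[c]>] conjugating [w] to the same element are equal, by semiregularity. *)
  have a_xy : a x = a y.
    apply/eqP; rewrite eq_mulgV1 -in_set1 -[[set 1]]/(1 : {set {perm dart M}}).
    rewrite -cCV -(minnormal_abelian_semireg minV (cycle_abelian c) Vw1).
    rewrite inE groupM ?groupV //=; apply/cent1P/commute_sym/commgP/conjg_fixP.
    by rewrite conjgM (psi_inj _ _ _ _ delta_xy) ?nVC // conjgK.
  by rewrite -(gax x) -(gax y) !gaE a_xy v_xy.
- apply: val_inj; rewrite permE /= tauV; case: (tauR x) => -> ->.
  by rewrite tauV [(_ + delta x)%R]addrC addrK.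
by apply: val_inj; rewrite permE /= drev_invol.
Qed.

End RegularMap.

(** * Rotation and affine automorphisms of the Paley map *)

Section PaleyMapEmbedding.

Local Open Scope ring_scope.

Variables (F : finFieldType) (S : {group {unit F}}) (SP : paley_set S).
Variables (s : {unit F}) (s_gen : generator S s).

Lemma paley_rotX i (a : paley_arc S) :
  val ((paley_rot s_gen ^+ i)%g a)
    = ((val a).1, (val a).1 + val s ^+ i * ((val a).2 - (val a).1)).
Proof.
elim: i => [|i IHi].
  by rewrite perm1 mul1r addrC subrK -surjective_pairing.
rewrite expgSr permM permE [LHS]/= IHi /= [_ + _ * _ - _]addrC addKr.
by rewrite mulrA exprS.
Qed.

(** As [s] generates [S], the rotation at a vertex runs through all its neighbours. *)
Lemma paley_porbit (a b : paley_arc S) :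
  (b \in porbit (paley_rot s_gen) a) = ((val b).1 == (val a).1).
Proof.
apply/porbitP/eqP => [[i ->] | eq1]; first by rewrite paley_rotX.
have /imsetP[u Su uE] := valP a; have /imsetP[v Sv vE] := valP b.
have /cycleP[i iE] : (v * u^-1)%g \in <[s]>%g.
  by rewrite -(eqP s_gen) groupM ?groupV.
exists i; apply: val_inj; rewrite paley_rotX -FinRing.val_unitX -iE.
rewrite -opprB uE mulrN -[_ * val u]/(val (v * u^-1 * u)%g) mulgKV -vE eq1.
by rewrite opprB addrC subrK -eq1 -surjective_pairing.
Qed.

Variables (a : {unit F}) (Sa : a \in S) (t : F).

Lemma affine_arc_subproof (x : paley_arc S) :
  paley_graph S (val a * (val x).1 + t) (val a * (val x).2 + t).
Proof.
rewrite /paley_graph opprD addrACA subrr addr0 -mulrBr.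
by apply: unit_setM => //; apply: (valP x).
Qed.

Definition affine_arc (x : paley_arc S) : paley_arc S :=
  Sub (val a * (val x).1 + t, val a * (val x).2 + t) (affine_arc_subproof x).

Lemma affine_arc_inj : injective affine_arc.
Proof.
move=> x y /(congr1 val) /= [/addIr/(mulfI (unit_neq0 a)) e1].
move=> /addIr/(mulfI (unit_neq0 a)) e2.
by apply: val_inj; rewrite [val x]surjective_pairing e1 e2 -surjective_pairing.
Qed.

Lemma affine_arc_rot x :
  affine_arc (paley_rot s_gen x) = paley_rot s_gen (affine_arc x).
Proof.
apply: val_inj; rewrite !permE /=; congr (_, _).
by rewrite opprD addrACA subrr addr0 -mulrBr mulrDr mulrCA addrAC.
Qed.

Lemma affine_arc_rev x :
  affine_arc (paley_rev SP x) = paley_rev SP (affine_arc x).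
Proof. by apply: val_inj; rewrite !permE. Qed.

End PaleyMapEmbedding.

(** * Maps isomorphic to a Paley map *)

Section PaleyMapIso.

Local Open Scope ring_scope.

Variables (F : finFieldType) (S : {group {unit F}}) (SP : paley_set S).
Variables (s : {unit F}) (s_gen : generator S s) (M : orimap).
Hypothesis isoM : orimap_iso M (paley_map SP s_gen).

Lemma paley_iso_embedding : embedding_of (paley_graph S) M.
Proof.
have [phi [[phi' phiK phi'K] phiR phiV]] := isoM.
pose f v := [set x | (val (phi x)).1 == v].
have phiX i x : phi ((drot M ^+ i)%g x) = (paley_rot s_gen ^+ i)%g (phi x).
  elim: i => [|i IHi]; first by rewrite !perm1.
  by rewrite !expgSr !permM phiR IHi.
have fE x : f (val (phi x)).1 = porbit (drot M) x.
  apply/setP => y; rewrite inE -(paley_porbit s_gen).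
  apply/porbitP/porbitP => -[i yE]; exists i.
    by apply: (can_inj phiK); rewrite phiX.
  by rewrite yE phiX.
pose base v := phi' (Sub (v, v - 1) (paley_base_subproof S v)).
have base1 v : (val (phi (base v))).1 = v by rewrite phi'K.
exists f; split.
- move=> u v /setP/(_ (base u)); rewrite !inE base1 eqxx.
  by move=> /esym/eqP.
- apply/setP => A; apply/imsetP/imsetP => [[v _ ->] | [x _ ->]].
    by exists (base v); rewrite // -fE base1.
  by exists (val (phi x)).1; rewrite // fE.
move=> u v; have [uv | nuv] := boolP (paley_graph S u v).
  rewrite (_ : [set x in _ | _] = [set phi' (Sub (u, v) uv)]) ?cards1 //.
  apply/setP => x; rewrite !inE phiV permE /=.
  apply/andP/eqP => [[/eqP e1 /eqP e2] | ->].
    apply: (can_inj phiK); rewrite phi'K; apply: val_inj => /=.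
    by rewrite -e1 -e2 -surjective_pairing.
  by rewrite !phi'K !eqxx.
apply/eqP; rewrite cards_eq0 -subset0; apply/subsetP => x.
rewrite !inE phiV permE /= => /andP[/eqP e1 /eqP e2].
by case/negP: nuv; rewrite -e1 -e2; apply: (valP (phi x)).
Qed.

Lemma paley_iso_regular : orientably_regular M.
Proof.
have [phi [[phi' phiK phi'K] phiR phiV]] := isoM.
pose x : dart M := phi' (Sub (0, 0 - 1) (paley_base_subproof S 0)).
apply/imsetP; exists x; rewrite ?inE //; apply/esym/setP => y; rewrite inE.
have /imsetP[a Sa aE] := valP (phi y).
(* With [a] the initial minus the terminal vertex of [phi y], this affine map takes the arc from 0
   to -1 to [phi y]. *)
pose g z := phi' (affine_arc Sa (val (phi y)).1 (phi z)).
have g_inj : injective g.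
  move=> z z' /(can_inj phi'K)/affine_arc_inj; exact: (can_inj phiK).
apply/imsetP; exists (perm g_inj).
  rewrite inE; apply/forallP => z; rewrite !permE /g.
  apply/andP; split; apply/eqP/(can_inj phiK).
    by rewrite !phiR !phi'K; apply: affine_arc_rot.
  by rewrite !phiV !phi'K; apply: affine_arc_rev.
rewrite /= /aperm permE /g phi'K; apply: (can_inj phiK); rewrite phi'K.
apply: val_inj; rewrite /= mulr0 add0r sub0r mulrN1 -[FinRing.uval a]aE.
by rewrite opprB subrK -surjective_pairing.
Qed.

End PaleyMapIso.

Theorem theorem4p1 (p e q n : nat) (F : finFieldType) (S : {group {unit F}})
    (p_prime : prime p) (qE : q = p ^ e) (card_F : #|F| = q)
    (n_gt0 : 0 < n) (n_dvd : n %| q - 1)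
    (n_even : 2 < p -> ~~ odd n)
    (order_p : mult_order p n e)
    (dvd_n : (q - 1) %/ (p - 1) %| n)
    (card_S : #|S| = n)
    (M : orimap) :
  (embedding_of (paley_graph S) M /\ orientably_regular M) <->
  (exists (s : {unit F}) (s_gen : generator S s),
      orimap_iso M
        (paley_map (paley_setP p_prime qE card_F n_even order_p card_S) s_gen)).
Proof.
split=> [[[f [f_inj fP f_adj]] regM] | [s [s_gen isoM]]]; last first.
  by split; [apply: paley_iso_embedding isoM | apply: paley_iso_regular isoM].
(* Generalising over the proof of [paley_set S] permits the substitution of [n] and [q]. *)
move: (paley_setP _ _ _ _ _ _) => SP; subst n q.
apply: (regular_map_paley regM p_prime card_F order_p dvd_n).
- rewrite (card_embedding f_inj fP f_adj) -sum_nat_const.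
  by apply: eq_bigr => u _; apply: paley_degree.
- move=> x; apply: (card_porbit_embedding f_inj fP f_adj) => u.
  exact: paley_degree.
exact: (embedding_simple fP f_adj).
Qed.
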